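(* For a fixed positive integer $k$, the problem MT-recognition can be solved in time $\mathcal{O}\left(n^3+2^{(k+2)\log k}\right)$ when the input graph $G$ has $n$ vertices and neighborhood diversity at most $k$.
   Context: All graphs are finite and simple. A graph $G$ is Maya-Tupi if its vertex set can be partitioned into two (possibly empty) sets $A$ and $B$ such that $\delta(G[A])\ge |A|-2$ (every vertex of $A$ is non-adjacent to at most one other vertex of $A$) and $\Delta(G[B])\le 1$. The decision problem MT-recognition is: given a graph $G$, is $G$ Maya-Tupi? Two vertices $u,v$ of $G$ have the same type if $N_G(u)\setminus\{v\}=N_G(v)\setminus\{u\}$. The neighborhood diversity of $G$ is the minimum integer $w$ such that $V(G)$ can be partitioned into $w$ sets such that all the vertices in each set have the same type. The logarithm is in base $2$, so $2^{(k+2)\log k}=k^{k+2}$. *)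

(* Defs.v *)
From mathcomp Require Import all_boot.

Set Implicit Arguments.
Unset Strict Implicit.
Unset Printing Implicit Defensive.

Record sgraph (T : finType) := SGraph {
  adj :> rel T;
  adj_sym : symmetric adj;
  adj_irr : irreflexive adj }.

Section Graphs.

Variables (T : finType) (G : sgraph T).

Definition nbh (v : T) : {set T} := [set u | G v u].

(* The degree of v in the induced subgraph G[A], for v in A. *)
Definition deg_in (A : {set T}) (v : T) : nat := #|nbh v :&: A|.

(* The first bound is deg >= #|A| - 2 in the integers.  Both degree bounds are
   vacuous on an empty part. *)
Definition maya_tupi_partition (A B : {set T}) : bool :=
  [&& A :|: B == setT, [disjoint A & B],
      [forall v in A, #|A| <= deg_in A v + 2] &
      [forall v in B, deg_in B v <= 1]].

Definition maya_tupi : bool :=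
  [exists A : {set T}, exists B : {set T}, maya_tupi_partition A B].

Definition same_type (u v : T) : bool := nbh u :\ v == nbh v :\ u.

Definition type_partition (P : {set {set T}}) : bool :=
  partition P [set: T] &&
  [forall S in P, forall u in S, forall v in S, same_type u v].

Fact nbh_diversity_subproof :
  exists w, [exists P, type_partition P && (#|P| == w)].
Proof.
exists #|preim_partition (@id T) setT|; apply/existsP.
exists (preim_partition id setT); rewrite eqxx andbT.
apply/andP; split; first exact: preim_partitionP.
apply/forall_inP => S /imsetP [x _ ->].
apply/forall_inP => u; rewrite !inE => /eqP <-.
by apply/forall_inP => v; rewrite !inE => /eqP <-; apply/eqP.
Qed.

(* [partition] requires nonempty blocks; this does not change the minimum. *)
Definition nbh_diversity : nat := ex_minn nbh_diversity_subproof.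

End Graphs.

(* A word RAM: registers are addressed directly and memory cells indirectly,
   through the value of a register.  Each instruction takes one time unit.  A
   program is constant-size, hence uses finitely many registers. *)
Inductive binop := Add | Sub | Mul | Div | Mod.

Definition eval_binop (o : binop) : nat -> nat -> nat :=
  match o with
  | Add => addn
  | Sub => subn
  | Mul => muln
  | Div => divn
  | Mod => modn
  end.

Inductive instr :=
  | Const (x a : nat)               (* reg x <- a *)
  | Move (x y : nat)                (* reg x <- reg y *)
  | Op (o : binop) (x y z : nat)    (* reg x <- reg y o reg z *)
  | Read (x y : nat)                (* reg x <- mem (reg y) *)
  | Write (x y : nat)               (* mem (reg x) <- reg y *)
  | Jump (l : nat)
  | JumpEq (x y l : nat)            (* jump to l if reg x = reg y *)
  | JumpLt (x y l : nat).           (* jump to l if reg x < reg y *)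

Definition program := seq instr.

Record state := State { pc : nat; reg : nat -> nat; mem : nat -> nat }.

(* Words range over [0, W).  Producing a larger value is a failure (None), so
   that no computation can exploit unit-cost arithmetic on long integers. *)
Definition set_reg (W : nat) (s : state) (x v : nat) : option state :=
  if v < W then Some (State (pc s).+1 [eta reg s with x |-> v] (mem s))
  else None.

Definition goto (s : state) (l : nat) : state := State l (reg s) (mem s).

Definition exec_instr (W : nat) (i : instr) (s : state) : option state :=
  match i with
  | Const x a => set_reg W s x a
  | Move x y => set_reg W s x (reg s y)
  | Op o x y z => set_reg W s x (eval_binop o (reg s y) (reg s z))
  | Read x y => set_reg W s x (mem s (reg s y))
  | Write x y =>
      Some (State (pc s).+1 (reg s) [eta mem s with reg s x |-> reg s y])
  | Jump l => Some (goto s l)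
  | JumpEq x y l => Some (goto s (if reg s x == reg s y then l else (pc s).+1))
  | JumpLt x y l => Some (goto s (if reg s x < reg s y then l else (pc s).+1))
  end.

(* The machine halts when the program counter leaves the program; a halted
   state has no successor. *)
Definition step (W : nat) (P : program) (s : state) : option state :=
  obind (fun i => exec_instr W i s) (onth P (pc s)).

Definition halted (P : program) (s : state) : bool := size P <= pc s.

Definition run (W : nat) (P : program) (t : nat) (s : state) : option state :=
  iter t (obind (step W P)) (Some s).

(* Memory holds the adjacency matrix of G in row-major order, register 0 the
   number of vertices; everything else is 0. *)
Definition input (n : nat) (G : sgraph 'I_n) : state :=
  State 0 (fun x => if x == 0 then n else 0)
    (fun a => [exists i : 'I_n, exists j : 'I_n, (a == i * n + j) && G i j]).

(* P on input G, with words of c * log (n + 2) bits, halts after at most t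
   steps with the answer b (0 or 1) in register 0. *)
Definition answers_within (c : nat) (P : program) (n : nat) (G : sgraph 'I_n)
    (b : bool) (t : nat) : Prop :=
  exists t' s, [/\ t' <= t, run (n.+2 ^ c) P t' (input G) = Some s,
                   halted P s & reg s 0 = b].

(* Main.v *)
Require Import Defs.
From mathcomp Require Import all_boot zify.

Set Implicit Arguments.
Unset Strict Implicit.
Unset Printing Implicit Defensive.

(* A partition is Maya-Tupi when every vertex clashes with at most one other
   vertex, a clash being a non-edge inside A or an edge inside B.  If v has five
   twins, three of them get the same colour, and then v can be given that colour
   too.  So it suffices to colour the kernel of those vertices that have fewer
   than five earlier twins; it is found in time O(n^3), and has at most five
   vertices in each of the k types.  Trying all its colourings takes time
   O(2^(5k) k^2), which is O(k^(k+2)) because 32^k = O(k^k).  The colourings are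
   enumerated by a binary counter kept in memory, since 2^(5k) may exceed the
   word size. *)

(** * A structured language compiled to the word RAM *)

Inductive cond := CEq (x y : nat) | CLt (x y : nat).

Definition jump_if (cd : cond) (l : nat) : instr :=
  match cd with CEq x y => JumpEq x y l | CLt x y => JumpLt x y l end.

Definition holds (cd : cond) (rs : seq nat) : bool :=
  match cd with
  | CEq x y => nth 0 rs x == nth 0 rs y
  | CLt x y => nth 0 rs x < nth 0 rs y
  end.

Inductive com :=
  | Skip
  | Do (i : instr)
  | Seq (c1 c2 : com)
  | If (cd : cond) (c1 c2 : com)
  | While (cd : cond) (c : com).

#[local] Coercion Do : instr >-> com.
#[local] Notation "c1 ;; c2" := (Seq c1 c2)
  (at level 61, right associativity).

Fixpoint csize (c : com) : nat :=
  match c with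
  | Skip => 0
  | Do _ => 1
  | Seq c1 c2 => csize c1 + csize c2
  | If _ c1 c2 => csize c2 + 2 + csize c1
  | While _ c => csize c + 3
  end.

(** Jump targets are absolute, hence the parameter [l], the address of the first instruction.
    Conditional jumps are taken when the condition is true, so the else branch is laid out first,
    and a loop starts with a jump over its own exit jump. *)
Fixpoint compile (l : nat) (c : com) : program :=
  match c with
  | Skip => [::]
  | Do i => [:: i]
  | Seq c1 c2 => compile l c1 ++ compile (l + csize c1) c2
  | If cd c1 c2 =>
      jump_if cd (l + csize c2 + 2) :: compile (l + 1) c2 ++
      Jump (l + csize c2 + 2 + csize c1) :: compile (l + csize c2 + 2) c1
  | While cd c =>
      jump_if cd (l + 2) :: Jump (l + csize c + 3) ::
      compile (l + 2) c ++ [:: Jump l]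
  end.

Lemma size_compile l c : size (compile l c) = csize c.
Proof.
elim: c l => //= [c1 IH1 c2 IH2|_ c1 IH1 c2 IH2|_ c IH] l.
- by rewrite size_cat IH1 IH2.
- by rewrite size_cat /= IH1 IH2; lia.
- by rewrite size_cat /= IH; lia.
Qed.

Fixpoint code_at (P : program) (l : nat) (p : program) : Prop :=
  match p with
  | [::] => True
  | i :: p' => onth P l = Some i /\ code_at P l.+1 p'
  end.

Lemma code_at_cat P l p q :
  code_at P l (p ++ q) <-> code_at P l p /\ code_at P (l + size p) q.
Proof.
elim: p l => [|i p IHp] l /=; first by rewrite addn0; split=> [|[]].
by rewrite IHp addSnnS; split=> [[? []]|[[]]].
Qed.

Lemma code_at_self p : code_at p 0 p.
Proof.
suff H q : code_at (q ++ p) (size q) p by have := H [::].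
elim: p q => //= i p IHp q; rewrite onth_cat ltnn subnn; split=> //.
by have := IHp (rcons q i); rewrite cat_rcons size_rcons.
Qed.

#[local] Arguments onth : simpl never.

(** * Hoare triples with time bounds *)

Section Triples.

Variable W : nat.

Lemma runD P t1 t2 s s1 :
  run W P t1 s = Some s1 -> run W P (t1 + t2) s = run W P t2 s1.
Proof. by rewrite /run addnC iterD => ->. Qed.

Lemma run_step P i t l f m s1 :
  onth P l = Some i -> exec_instr W i (State l f m) = Some s1 ->
  run W P t.+1 (State l f m) = run W P t s1.
Proof.
move=> Hi He; rewrite -add1n; apply: runD.
by rewrite /run /= /step [pc _]/= Hi /= He.
Qed.

(* Registers are given by a finite list, so that symbolic execution computes
   them; the machine only sees that list up to pointwise equality. *)
Definition tri (c : com) (rs : seq nat) (m : nat -> nat) (t : nat)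
    (Q : seq nat -> (nat -> nat) -> Prop) : Prop :=
  forall P l f, code_at P l (compile l c) -> f =1 nth 0 rs ->
  exists t' f' rs' m',
    [/\ t' <= t,
        run W P t' (State l f m) = Some (State (l + csize c) f' m'),
        f' =1 nth 0 rs' & Q rs' m'].

(** Any bound [t] is accepted, so a final [Skip] absorbs the slack in the time budget of a block. *)
Lemma tri_skip rs m t (Q : _ -> _ -> Prop) : Q rs m -> tri Skip rs m t Q.
Proof. by move=> HQ P l f _ Hf; exists 0, f, rs, m; rewrite addn0; split. Qed.

Lemma tri_conseq c rs m t t' (Q Q' : _ -> _ -> Prop) :
  tri c rs m t' Q' -> t' <= t -> (forall rs' m', Q' rs' m' -> Q rs' m') ->
  tri c rs m t Q.
Proof.
move=> H le_t HQ P l f HP /(H P l f HP)[u [f' [rs' [m' [le_u Hr Hf' HQ']]]]].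
by exists u, f', rs', m'; split=> //; [apply: leq_trans le_t|apply: HQ].
Qed.

Lemma tri_seq t1 t2 (R : _ -> _ -> Prop) c1 c2 rs m t Q :
  tri c1 rs m t1 R -> t1 + t2 <= t ->
  (forall rs' m', R rs' m' -> tri c2 rs' m' t2 Q) ->
  tri (Seq c1 c2) rs m t Q.
Proof.
move=> H1 le_t H2 P l f /= /code_at_cat[HP1 HP2] Hf.
rewrite size_compile in HP2.
have [u1 [f1 [rs1 [m1 [le_u1 Hr1 Hf1 /H2 H2']]]]] := H1 P l f HP1 Hf.
have [u2 [f2 [rs2 [m2 [le_u2 Hr2 Hf2 HQ]]]]] := H2' P _ f1 HP2 Hf1.
exists (u1 + u2), f2, rs2, m2; split=> //; first by lia.
by rewrite (runD u2 Hr1) addnA.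
Qed.

Lemma exec_jump_if cd l rs f m p : f =1 nth 0 rs ->
  exec_instr W (jump_if cd l) (State p f m) =
  Some (State (if holds cd rs then l else p.+1) f m).
Proof. by move=> Hf; case: cd => x y; rewrite /= !Hf. Qed.

(** The two extra steps are the conditional jump and, after the else branch, the jump over the then
    branch. *)
Lemma tri_if cd c1 c2 rs m t Q :
  (holds cd rs -> tri c1 rs m t Q) -> (~~ holds cd rs -> tri c2 rs m t Q) ->
  tri (If cd c1 c2) rs m t.+2 Q.
Proof.
move=> H1 H2 P l f /= [HPj /code_at_cat[HP2 /= [HPJ HP1]]] Hf.
rewrite size_compile in HPJ HP1; rewrite addn1 in HP2.
have Hj := exec_jump_if cd (l + csize c2 + 2) m l Hf.
case: ifPn Hj => Hcd Hj.
  have HP1' : code_at P (l + csize c2 + 2) (compile (l + csize c2 + 2) c1).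
    by move: HP1; rewrite (_ : (l.+1 + _).+1 = l + csize c2 + 2) //; lia.
  have [u [f' [rs' [m' [le_u Hr Hf' HQ]]]]] := H1 Hcd P _ f HP1' Hf.
  exists u.+1, f', rs', m'; split=> //; first by lia.
  by rewrite (run_step _ HPj Hj) Hr !addnA.
have [u [f' [rs' [m' [le_u Hr Hf' HQ]]]]] := H2 Hcd P _ f HP2 Hf.
exists (u + 1).+1, f', rs', m'; split=> //; first by lia.
rewrite (run_step _ HPj Hj) (runD _ Hr) (run_step _ HPJ erefl) //=.
by rewrite /run /= /goto /= !addnA.
Qed.

(* The index of the invariant bounds the number of remaining iterations. *)
Lemma tri_while (I : nat -> seq nat -> (nat -> nat) -> Prop) tb cd c Q :
  (forall d rs m, I d rs m -> holds cd rs ->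
     tri c rs m tb (fun rs' m' => exists2 d', d' < d & I d' rs' m')) ->
  (forall d rs m, I d rs m -> ~~ holds cd rs -> Q rs m) ->
  forall d rs m, I d rs m -> tri (While cd c) rs m (d * (tb + 2) + 2) Q.
Proof.
move=> Hc HQ d rs m HI P l f /= [HPj [HPe /code_at_cat[HPc /= [HPl _]]]].
move: HPc HPl; rewrite size_compile -addn2 => HPc HPl.
(* Strong induction, because one round may lower the index by more than one. A round costs [tb] plus
   the test and the jump back. *)
elim/ltn_ind: d rs m HI f => d IHd rs m HI f Hf.
have Hj := exec_jump_if cd (l + 2) m l Hf.
case: ifPn Hj => Hcd Hj.
  have [u1 [f1 [rs1 [m1 [le_u1 Hr1 Hf1 [d1 lt_d HI1]]]]]] :=
    Hc d rs m HI Hcd P _ f HPc Hf.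
  have [u [f' [rs' [m' [le_u Hr Hf' HQ']]]]] := IHd d1 lt_d rs1 m1 HI1 f1 Hf1.
  exists (u1 + u.+1).+1, f', rs', m'; split=> //; first by nia.
  rewrite (run_step _ HPj Hj) (runD _ Hr1).
  by rewrite (run_step _ HPl erefl).
exists 2, f, rs, m; split=> //; [by lia| |exact: HQ HI Hcd].
rewrite (run_step _ HPj Hj) (run_step _ HPe erefl) /=.
by rewrite /run /= /goto /= !addnA.
Qed.

(** Counting loops: the index given to [tri_while] is the number [N - i] of rounds left. The body
    itself increments the counter. *)
Lemma tri_for (I : nat -> seq nat -> (nat -> nat) -> Prop) N tb x y c :
  (forall i rs m, I i rs m -> nth 0 rs x = i /\ nth 0 rs y = N) ->
  (forall i rs m, i < N -> I i rs m -> tri c rs m tb (I i.+1)) ->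
  forall rs m, I 0 rs m ->
    tri (While (CLt x y) c) rs m (N * (tb + 2) + 2) (I N).
Proof.
move=> Hxy Hc rs m HI0.
pose J d rs' m' := exists2 i, (i <= N) && (d == N - i) & I i rs' m'.
apply: (tri_while (I := J)).
- move=> d rs1 m1 [i /andP[le_i /eqP->] HI] /=; have [-> ->] := Hxy _ _ _ HI.
  move=> lt_i; apply: tri_conseq (Hc _ _ _ lt_i HI) _ _ => // rs2 m2 HI2.
  by exists (N - i.+1); [lia|exists i.+1; rewrite // lt_i eqxx].
- move=> d rs1 m1 [i /andP[le_i _] HI] /=; have [-> ->] := Hxy _ _ _ HI.
  rewrite -leqNgt => ge_i; rewrite (_ : N = i) //.
  by apply/eqP; rewrite eqn_leq ge_i.
- by exists 0; rewrite /= ?subn0 ?eqxx.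
Qed.

(** The common form of the rules for register instructions. The continuation [c] is included so that
    execution proceeds forwards on an explicit register list; [v < W] excludes failure by
    overflow. *)
Lemma tri_reg i x v c rs m t Q :
  (forall p f, f =1 nth 0 rs ->
     exec_instr W i (State p f m) = set_reg W (State p f m) x v) ->
  v < W -> tri c (set_nth 0 rs x v) m t Q -> tri (Seq (Do i) c) rs m t.+1 Q.
Proof.
move=> Hi lt_v Hc P l f /= [HPi]; rewrite addn1 => HPc Hf.
have Hf1 : [eta f with x |-> v] =1 nth 0 (set_nth 0 rs x v).
  by move=> y; rewrite nth_set_nth /= Hf.
have [u [f' [rs' [m' [le_u Hr Hf' HQ]]]]] := Hc P _ _ HPc Hf1.
exists u.+1, f', rs', m'; split=> //.
have He := Hi l _ Hf; rewrite /set_reg lt_v in He.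
by rewrite (run_step _ HPi He) Hr addnA addn1.
Qed.

Lemma tri_const x a c rs m t Q :
  a < W -> tri c (set_nth 0 rs x a) m t Q ->
  tri (Seq (Do (Const x a)) c) rs m t.+1 Q.
Proof. by apply: tri_reg. Qed.

Lemma tri_move x y c rs m t Q :
  nth 0 rs y < W -> tri c (set_nth 0 rs x (nth 0 rs y)) m t Q ->
  tri (Seq (Do (Move x y)) c) rs m t.+1 Q.
Proof. by apply: tri_reg => p f Hf /=; rewrite Hf. Qed.

Lemma tri_op o x y z c rs m t Q :
  let v := eval_binop o (nth 0 rs y) (nth 0 rs z) in
  v < W -> tri c (set_nth 0 rs x v) m t Q ->
  tri (Seq (Do (Op o x y z)) c) rs m t.+1 Q.
Proof. by apply: tri_reg => p f Hf /=; rewrite !Hf. Qed.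

Lemma tri_read x y v c rs m t Q :
  m (nth 0 rs y) = v ->
  v < W -> tri c (set_nth 0 rs x v) m t Q ->
  tri (Seq (Do (Read x y)) c) rs m t.+1 Q.
Proof. by move=> <-; apply: tri_reg => p f Hf /=; rewrite Hf. Qed.

Lemma tri_write x y c rs m t Q :
  tri c rs [eta m with nth 0 rs x |-> nth 0 rs y] t Q ->
  tri (Seq (Do (Write x y)) c) rs m t.+1 Q.
Proof.
move=> Hc P l f /= [HPi]; rewrite addn1 => HPc Hf.
have [u [f' [rs' [m' [le_u Hr Hf' HQ]]]]] := Hc P _ _ HPc Hf.
exists u.+1, f', rs', m'; split=> //.
by rewrite (run_step _ HPi erefl) /= !Hf Hr addnA addn1.
Qed.
End Triples.

(** * Computing the kernel *)

Lemma iota_recr k : iota 0 k.+1 = rcons (iota 0 k) k.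
Proof. by rewrite -addn1 iotaD cats1. Qed.

Lemma count_iotaS (p : pred nat) k :
  count p (iota 0 k.+1) = count p (iota 0 k) + p k.
Proof. by rewrite iota_recr -cats1 count_cat /= addn0. Qed.

Lemma all_iotaS (p : pred nat) k :
  all p (iota 0 k.+1) = all p (iota 0 k) && p k.
Proof. by rewrite iota_recr all_rcons andbC. Qed.

Lemma count_iota_le (p : pred nat) k : count p (iota 0 k) <= k.
Proof. by rewrite -[leqRHS](size_iota 0) count_size. Qed.

Lemma addr_lt n u v : u < n -> v < n -> u * n + v < n * n.
Proof. nia. Qed.

Definition twin (g : nat -> nat -> bool) n u v : bool :=
  all (fun z => [|| z == u, z == v | g u z == g v z]) (iota 0 n).

Definition in_kernel g n v : bool :=
  count (fun u => twin g n u v) (iota 0 v) < 5.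

Definition kernel g n v : seq nat := [seq x <- iota 0 v | in_kernel g n x].

(* Registers: 0 holds n; 1 and 2 the constants 1 and 5; 3 is n^2, the address of
   the kernel list; 4 its length m; 5 is n^2 + n, the address of the colour
   bits; 6 is the stopping flag and 14 the answer.  7, 8 and 9 are loop
   variables (9 also is scratch, and the carry in [carry_body]), 10 a counter
   (the constant 2 in [carry_body]), 11 a flag, 12 and 13 scratch. *)
Definition twin_body : com :=
  If (CEq 9 8) Skip (If (CEq 9 7) Skip
    (Op Mul 12 8 0 ;; Op Add 12 12 9 ;; Read 12 12 ;;
     Op Mul 13 7 0 ;; Op Add 13 13 9 ;; Read 13 13 ;;
     If (CEq 12 13) Skip (Const 11 1 ;; Skip))) ;;
  Op Add 9 9 1 ;; Skip.

Definition earlier_body : com :=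
  Const 11 0 ;; Const 9 0 ;; While (CLt 9 0) twin_body ;;
  If (CLt 11 1) (Op Add 10 10 1 ;; Skip) Skip ;;
  Op Add 8 8 1 ;; Skip.

Definition kernel_body : com :=
  Const 10 0 ;; Const 8 0 ;; While (CLt 8 7) earlier_body ;;
  If (CLt 10 2)
    (Op Add 12 3 4 ;; Write 12 7 ;; Op Add 4 4 1 ;; Skip) Skip ;;
  Op Add 7 7 1 ;; Skip.

Section Run.

Variables (W n : nat) (g : nat -> nat -> bool).
(** All addresses fit in a word: [n * n] cells for the matrix, at most [n] for the kernel list and
    at most [n] for the colour bits. The 8 leaves room for the small constants. *)
Hypothesis HW : n * n + 2 * n + 8 <= W.

Definition st m d i j z c f a b r : seq nat :=
  [:: n; 1; 5; n * n; m; n * n + n; d; i; j; z; c; f; a; b; r].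

Definition adj_mem (mem : nat -> nat) : Prop :=
  forall u v, u < n -> v < n -> mem (u * n + v) = g u v.

Lemma twin_loop mem m d i j c a b r : adj_mem mem -> i < n -> j < n ->
  tri W (While (CLt 9 0) twin_body) (st m d i j 0 c 0 a b r) mem
    (n * (20 + 2) + 2)
    (fun rs mem' => mem' = mem /\
       exists a b, rs = st m d i j n c (~~ twin g n j i) a b r).
Proof.
move=> Hm lt_i lt_j.
pose test z := [|| z == j, z == i | g j z == g i z].
pose I z rs mem' := mem' = mem /\
  exists a b, rs = st m d i j z c (~~ all test (iota 0 z)) a b r.
apply: (tri_for (I := I)); first by move=> z rs m' [_ [a' [b' ->]]].
  move=> z _ _ lt_z [-> [a' [b' ->]]]; rewrite /twin_body.
  pose R rs mem' := mem' = mem /\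
    exists a b, rs = st m d i j z c (~~ all test (iota 0 z.+1)) a b r.
  have EI : all test (iota 0 z.+1) = all test (iota 0 z) && test z.
    by rewrite -addn1 iotaD all_cat /= andbT.
  apply: (tri_seq (t1 := 17) (t2 := 3) (R := R)) => //.
    apply: tri_if => /= [/eqP Ej|Nj].
      apply: tri_skip; split=> //; exists a', b'.
      by rewrite EI /test Ej eqxx andbT.
    apply: tri_if => /= [/eqP Ei|Ni].
      apply: tri_skip; split=> //; exists a', b'.
      by rewrite EI /test Ei eqxx orbT andbT.
    have := addr_lt lt_i lt_z; have := addr_lt lt_j lt_z => Bj Bi.
    apply: tri_op => /=; first by lia.
    apply: tri_op => /=; first by lia.
    apply: (tri_read (v := g j z)) => /=; first exact: Hm.
      by case: (g j z); lia.
    apply: tri_op => /=; first by lia.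
    apply: tri_op => /=; first by lia.
    apply: (tri_read (v := g i z)) => /=; first exact: Hm.
      by case: (g i z); lia.
    have Et : test z = (g j z == g i z).
      by rewrite /test (negPf Nj) (negPf Ni).
    apply: tri_if => /= Eg.
      apply: tri_skip; split=> //; exists (g j z), (g i z).
      rewrite EI Et (_ : (g j z == g i z)) ?andbT //.
      by case: (g j z) (g i z) Eg => [] [].
    apply: tri_const => /=; first by lia.
    apply: tri_skip; split=> //; exists (g j z), (g i z).
    rewrite EI Et (negPf (_ : g j z != g i z)) ?andbF //.
    by case: (g j z) (g i z) Eg => [] [].
  move=> _ _ [-> [a1 [b1 ->]]].
  apply: tri_op => /=; first by lia.
  by apply: tri_skip; split=> //; exists a1, b1; rewrite addn1.
by split=> //; exists a, b.
Qed.

Lemma earlier_loop mem m d i z f a b r : adj_mem mem -> i < n ->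
  tri W (While (CLt 8 7) earlier_body) (st m d i 0 z 0 f a b r) mem
    (i * (10 + n * 22 + 2) + 2)
    (fun rs mem' => mem' = mem /\ exists z f a b,
       rs = st m d i i z (count (fun u => twin g n u i) (iota 0 i)) f a b r).
Proof.
move=> Hm lt_i; set p : pred nat := fun u => twin g n u i.
pose I j rs mem' := mem' = mem /\
  exists z f a b, rs = st m d i j z (count p (iota 0 j)) f a b r.
apply: (tri_for (I := I)); first by move=> j rs m' [_ [? [? [? [? ->]]]]].
  move=> j _ _ lt_j [-> [z' [f' [a' [b' ->]]]]]; rewrite /earlier_body.
  have le_c := count_iota_le p j.
  have lt_c : count p (iota 0 j) + 1 < W by lia.
  apply: tri_const => /=; first by lia.
  apply: tri_const => /=; first by lia.
  apply: (tri_seq (t2 := 5) (twin_loop Hm lt_i (ltn_trans lt_j lt_i))) => //;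
    first by lia.
  move=> _ _ [-> [a1 [b1 ->]]].
  pose R rs mem' := mem' = mem /\
    exists a b, rs = st m d i j n (count p (iota 0 j.+1)) (~~ p j) a b r.
  have EI := count_iotaS p j.
  apply: (tri_seq (t1 := 3) (t2 := 2) (R := R)) => //.
    apply: tri_if => /=; rewrite -/(p j); case Ep: (p j) => // _.
      apply: tri_op => /=; first exact: lt_c.
      by apply: tri_skip; split=> //; exists a1, b1; rewrite EI Ep.
    by apply: tri_skip; split=> //; exists a1, b1; rewrite EI Ep addn0.
  move=> _ _ [-> [a2 [b2 ->]]].
  apply: tri_op => /=; first by lia.
  apply: tri_skip; split=> //; exists n, (~~ p j), a2, b2.
  by rewrite addn1.
by split=> //; exists z, f, a, b.
Qed.

Definition list_mem (L : seq nat) (mem : nat -> nat) : Prop :=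
  forall i, i < size L -> mem (n * n + i) = nth 0 L i.

Lemma size_kernel v : size (kernel g n v) <= v.
Proof. by rewrite size_filter count_iota_le. Qed.

Lemma kernelS v :
  kernel g n v.+1 = if in_kernel g n v then rcons (kernel g n v) v
                    else kernel g n v.
Proof.
rewrite /kernel -addn1 iotaD filter_cat /=.
by case: ifP; rewrite ?cats0 ?cats1.
Qed.

(** The cells from [n * n + n] on are shown to remain zero because they become the colour bits: the
    binary counter then starts at 0 without initialisation. *)
Lemma kernel_loop mem j z c f a b :
  adj_mem mem -> (forall x, n * n <= x -> mem x = 0) ->
  tri W (While (CLt 7 0) kernel_body) (st 0 0 0 j z c f a b 0) mem
    (n * (12 + n * (n * 22 + 12) + 2) + 2)
    (fun rs mem' => [/\ adj_mem mem', list_mem (kernel g n n) mem',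
       forall x, n * n + n <= x -> mem' x = 0 &
       exists j z c f a b,
         rs = st (size (kernel g n n)) 0 n j z c f a b 0]).
Proof.
move=> Hm H0.
pose I i rs mem' := [/\ adj_mem mem', list_mem (kernel g n i) mem',
   forall x, n * n + i <= x -> mem' x = 0 &
   exists j z c f a b, rs = st (size (kernel g n i)) 0 i j z c f a b 0].
apply: (tri_for (I := I)).
- by move=> i rs m' [_ _ _ [? [? [? [? [? [? ->]]]]]]].
- move=> i _ mem1 lt_i [Hm1 HL Hz [j1 [z1 [c1 [f1 [a1 [b1 ->]]]]]]].
  rewrite /kernel_body.
  apply: tri_const => /=; first by lia.
  apply: tri_const => /=; first by lia.
  apply: (tri_seq (t2 := 7) (earlier_loop Hm1 lt_i)); first by nia.
  move=> _ _ [-> [z2 [f2 [a2 [b2 ->]]]]].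
  set cnt := count _ _.
  have Ecnt : in_kernel g n i = (cnt < 5) by [].
  have lt_s := size_kernel i.
  pose R rs mem' := [/\ adj_mem mem', list_mem (kernel g n i.+1) mem',
   forall x, n * n + i.+1 <= x -> mem' x = 0 &
   exists a, rs = st (size (kernel g n i.+1)) 0 i i z2 cnt f2 a b2 0].
  apply: (tri_seq (t1 := 5) (t2 := 2) (R := R)) => //.
    apply: tri_if => /=; rewrite -Ecnt => Hk.
      apply: tri_op => /=; first by lia.
      apply: tri_write => /=.
      apply: tri_op => /=; first by lia.
      apply: tri_skip; rewrite /R kernelS Hk; split.
      - move=> u v lt_u lt_v /=; have := addr_lt lt_u lt_v.
        by case: eqP => [|_]; [lia|rewrite Hm1].
      - move=> x; rewrite size_rcons ltnS /= eqn_add2l nth_rcons => le_x.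
        by case: ltngtP le_x => // lt_x _; rewrite HL.
      - move=> x le_x /=; case: eqP => [|_]; first by lia.
        by apply: Hz; lia.
      - by exists (n * n + size (kernel g n i)); rewrite size_rcons addn1.
    apply: tri_skip; rewrite /R kernelS (negPf Hk); split=> //; last by exists a2.
    by move=> x le_x; apply: Hz; lia.
  move=> _ mem2 [Hm2 HL2 Hz2 [a3 ->]].
  apply: tri_op => /=; first by lia.
  apply: tri_skip; split=> //; exists i, z2, cnt, f2, a3, b2.
  by rewrite addn1.
- by split=> //; [move=> x; rewrite addn0; apply: H0|exists j, z, c, f, a, b].
Qed.

End Run.

(** * Searching for a colouring of the kernel *)

(** Colours are attached to positions in [L] rather than to vertices, since this is how the program
    stores them. *)
Definition conflict (g : nat -> nat -> bool) L (b : nat -> bool) i j : bool :=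
  [&& i != j, b i == b j & g (nth 0 L i) (nth 0 L j) == b i].

Definition valid g L b : bool :=
  all (fun i => count (conflict g L b i) (iota 0 (size L)) <= 1)
      (iota 0 (size L)).

(** * Colourings as binary numbers *)

Definition value m (b : nat -> bool) : nat := \sum_(i < m) b i * 2 ^ i.

Lemma valueS m b : value m.+1 b = value m b + b m * 2 ^ m.
Proof. by rewrite /value big_ord_recr. Qed.

Lemma value_lt m b : value m b < 2 ^ m.
Proof.
elim: m => [|m IHm]; first by rewrite /value big_ord0.
rewrite valueS expnS; case: (b m); lia.
Qed.

Lemma eq_value m b b' :
  (forall i, i < m -> b i = b' i) -> value m b = value m b'.
Proof. by move=> Hb; apply: eq_bigr => i _; rewrite Hb. Qed.

Lemma value_inj m b b' :
  value m b = value m b' -> forall i, i < m -> b i = b' i.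
Proof.
elim: m => // m IHm; rewrite !valueS => E i.
have := value_lt m b; have := value_lt m b' => lt' lt.
(* The lower bits contribute less than [2 ^ m], so the top bits must agree. *)
have Eb : b m = b' m by case: (b m) (b' m) E => [] []; lia.
rewrite ltnS leq_eqVlt => /predU1P[->//|]; apply: IHm.
by move: E; rewrite Eb => /addIn.
Qed.

Lemma eq_valid g L b b' :
  (forall i, i < size L -> b i = b' i) -> valid g L b = valid g L b'.
Proof.
move=> Hb; apply: eq_in_all => i; rewrite mem_iota add0n => /= lt_i.
congr (_ <= _); apply: eq_in_count => j; rewrite mem_iota add0n => /= lt_j.
by rewrite /conflict !Hb.
Qed.

(* The bit of a vertex is its colour, 1 for B and 0 for A, so that a pair is in
   conflict exactly when both bits equal the adjacency bit. *)
Definition pair_body : com :=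
  If (CEq 7 8) Skip
    (Op Add 12 5 7 ;; Read 12 12 ;; Op Add 13 5 8 ;; Read 13 13 ;;
     If (CEq 12 13)
       (Op Add 9 3 7 ;; Read 9 9 ;; Op Mul 9 9 0 ;;
        Op Add 13 3 8 ;; Read 13 13 ;; Op Add 9 9 13 ;; Read 9 9 ;;
        If (CEq 9 12) (Op Add 10 10 1 ;; Skip) Skip)
       Skip) ;;
  Op Add 8 8 1 ;; Skip.

Definition vertex_body : com :=
  Const 10 0 ;; Const 8 0 ;; While (CLt 8 4) pair_body ;;
  If (CLt 1 10) (Const 11 0 ;; Skip) Skip ;;
  Op Add 7 7 1 ;; Skip.

Definition carry_body : com :=
  Op Add 12 5 7 ;; Read 13 12 ;; Op Add 13 13 9 ;;
  Op Div 9 13 10 ;; Op Mod 13 13 10 ;; Write 12 13 ;;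
  Op Add 7 7 1 ;; Skip.

(** The initial carry 1 in register 9 is the increment. The carry out of the last bit is moved to
    register 6, so the same flag stops the loop on success and when the counter overflows. *)
Definition search_body : com :=
  Const 11 1 ;; Const 7 0 ;; While (CLt 7 4) vertex_body ;;
  If (CEq 11 1) (Const 14 1 ;; Const 6 1 ;; Skip)
    (Const 9 1 ;; Const 10 2 ;; Const 7 0 ;; While (CLt 7 4) carry_body ;;
     Move 6 9 ;; Skip).

Section Run.

Variables (W n : nat) (g : nat -> nat -> bool) (L : seq nat).
Hypothesis HW : n * n + 2 * n + 8 <= W.
Hypothesis HL : forall i, i < size L -> nth 0 L i < n.
Hypothesis size_L : size L <= n.

Notation m := (size L).
Notation st := (st n m).

Definition bit_mem (b : nat -> bool) (mem : nat -> nat) : Prop :=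
  forall i, i < m -> mem (n * n + n + i) = b i.

Definition search_mem b mem : Prop :=
  [/\ adj_mem n g mem, list_mem n L mem & bit_mem b mem].

Lemma bool_W (b : bool) : b < W.
Proof. by case: b; lia. Qed.

Lemma eqn_bool (a b : bool) : (a == b :> nat) = (a == b).
Proof. by case: a b => [] []. Qed.

Lemma pair_loop b mem d i z f x y r : search_mem b mem -> i < m ->
  tri W (While (CLt 8 4) pair_body) (st d i 0 z 0 f x y r) mem
    (m * (20 + 2) + 2)
    (fun rs mem' => mem' = mem /\ exists z x y, rs = st d i m z
       (count (conflict g L b i) (iota 0 m)) f x y r).
Proof.
move=> [Hm Hl Hb] lt_i; set p : pred nat := conflict g L b i.
pose I j rs mem' := mem' = mem /\
  exists z x y, rs = st d i j z (count p (iota 0 j)) f x y r.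
apply: (tri_for (I := I)); first by move=> j rs m' [_ [? [? [? ->]]]].
  move=> j _ _ lt_j [-> [z1 [x1 [y1 ->]]]]; rewrite /pair_body.
  have le_c := count_iota_le p j.
  have lt_c : count p (iota 0 j) + 1 < W by lia.
  pose R rs mem' := mem' = mem /\
    exists z x y, rs = st d i j z (count p (iota 0 j.+1)) f x y r.
  apply: (tri_seq (t1 := 18) (t2 := 2) (R := R)) => //.
    have done_false z2 x2 y2 t : p j = false ->
      tri W Skip (st d i j z2 (count p (iota 0 j)) f x2 y2 r) mem t R.
      move=> Ep; apply: tri_skip; split=> //; exists z2, x2, y2.
      by rewrite count_iotaS Ep addn0.
    apply: tri_if => /= [/eqP Ei|/negPf Ni].
      by apply: done_false; rewrite /p /conflict Ei eqxx.
    apply: tri_op => /=; first by lia.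
    apply: (tri_read (v := b i)) => /=; [exact: Hb|exact: bool_W|].
    apply: tri_op => /=; first by lia.
    apply: (tri_read (v := b j)) => /=; [exact: Hb|exact: bool_W|].
    apply: tri_if => /=; rewrite eqn_bool => Eb; last first.
      by apply: done_false; rewrite /p /conflict (negPf Eb) andbF.
    have := HL lt_i; have := HL lt_j => ltj lti.
    have lt_a := addr_lt lti ltj.
    apply: tri_op => /=; first by lia.
    apply: (tri_read (v := nth 0 L i)) => /=; [exact: Hl|by lia|].
    apply: tri_op => /=; first by lia.
    apply: tri_op => /=; first by lia.
    apply: (tri_read (v := nth 0 L j)) => /=; [exact: Hl|by lia|].
    apply: tri_op => /=; first by lia.
    apply: (tri_read (v := g (nth 0 L i) (nth 0 L j))) => /=;
      [exact: Hm|exact: bool_W|].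
    apply: tri_if => /=; rewrite eqn_bool => Eg; last first.
      by apply: done_false; rewrite /p /conflict (negPf Eg) !andbF.
    apply: tri_op => /=; first exact: lt_c.
    apply: tri_skip; split=> //; do 3!eexists; rewrite count_iotaS.
    by rewrite (_ : p j = true) // /p /conflict Ni Eb Eg.
  move=> _ _ [-> [z2 [x2 [y2 ->]]]].
  apply: tri_op => /=; first by lia.
  by apply: tri_skip; split=> //; exists z2, x2, y2; rewrite addn1.
by split=> //; exists z, x, y.
Qed.

Lemma vertex_loop b mem d j z c x y r : search_mem b mem ->
  tri W (While (CLt 7 4) vertex_body) (st d 0 j z c 1 x y r) mem
    (m * (10 + m * 22 + 2) + 2)
    (fun rs mem' => mem' = mem /\ exists j z c x y,
       rs = st d m j z c (valid g L b) x y r).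
Proof.
move=> Hmem.
pose p i := count (conflict g L b i) (iota 0 m) <= 1.
pose I i rs mem' := mem' = mem /\ exists j z c x y,
  rs = st d i j z c (all p (iota 0 i)) x y r.
apply: (tri_for (I := I)); first by move=> i rs m' [_ [? [? [? [? [? ->]]]]]].
  move=> i _ _ lt_i [-> [j1 [z1 [c1 [x1 [y1 ->]]]]]]; rewrite /vertex_body.
  apply: tri_const => /=; first by lia.
  apply: tri_const => /=; first by lia.
  apply: (tri_seq (t2 := 5) (pair_loop Hmem lt_i)); first by lia.
  move=> _ _ [-> [z2 [x2 [y2 ->]]]].
  set c2 := count _ _; have Ep : p i = (c2 <= 1) by [].
  pose R rs mem' := mem' = mem /\
    rs = st d i m z2 c2 (all p (iota 0 i.+1)) x2 y2 r.
  apply: (tri_seq (t1 := 3) (t2 := 2) (R := R)) => //.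
    apply: tri_if => /=; rewrite ?ltnNge -Ep => Hp.
      apply: tri_const => /=; first by lia.
      by apply: tri_skip; split=> //; rewrite all_iotaS (negPf Hp) andbF.
    rewrite negbK in Hp.
    by apply: tri_skip; split=> //; rewrite all_iotaS Hp andbT.
  move=> _ _ [-> ->].
  apply: tri_op => /=; first by lia.
  by apply: tri_skip; split=> //; exists m, z2, c2, x2, y2; rewrite addn1.
by split=> //; exists j, z, c, x, y.
Qed.

(* After [i] rounds the low [i] bits of the new number, with the pending carry
   at weight 2^i, represent those of the old one plus 1. *)
Lemma carry_loop b mem d j f x y r : search_mem b mem ->
  tri W (While (CLt 7 4) carry_body) (st d 0 j 1 2 f x y r) mem
    (m * (8 + 2) + 2)
    (fun rs mem' => exists b' (k : bool) x y,
       [/\ search_mem b' mem', value m b' + k * 2 ^ m = value m b + 1 &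
           rs = st d m j k 2 f x y r]).
Proof.
move=> Hmem.
(* The clause on [l] says that the bits not yet reached are still those of [b]; it lets the next
   round add the [i]-th bit of [b] to both sides. *)
pose I i rs mem' := exists b' (k : bool) x y,
  [/\ search_mem b' mem', value i b' + k * 2 ^ i = value i b + 1,
      forall l, i <= l -> b' l = b l & rs = st d i j k 2 f x y r].
have H : tri W (While (CLt 7 4) carry_body) (st d 0 j 1 2 f x y r) mem
    (m * (8 + 2) + 2) (I m).
  apply: (tri_for (I := I)).
  - by move=> i rs m' [? [? [? [? [_ _ _ ->]]]]].
  - move=> i _ mem1 lt_i [b' [k [x1 [y1 [[Hm Hl Hb] Hv Heq ->]]]]].
    rewrite /carry_body.
    apply: tri_op => /=; first by lia.
    apply: (tri_read (v := b' i)) => /=; [exact: Hb|exact: bool_W|].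
    have := bool_W (b' i); have := bool_W k => Wk Wb.
    apply: tri_op => /=; first by case: (b' i) (k) => [] []; lia.
    apply: tri_op => /=; first by case: (b' i) (k) => [] []; lia.
    (* A half adder: the quotient by 2 is the new carry and the remainder is the new bit. *)
    have -> : (b' i + k) %/ 2 = (b' i && k) by case: (b' i) (k) => [] [].
    apply: tri_op => /=; first by case: (b' i) (k) => [] []; rewrite /=; lia.
    have -> : (b' i + k) %% 2 = (b' i (+) k) by case: (b' i) (k) => [] [].
    apply: tri_write => /=.
    apply: tri_op => /=; first by lia.
    apply: tri_skip.
    exists [eta b' with i |-> b' i (+) k], (b' i && k), (n * n + n + i), (b' i (+) k).
    split; first split.
    + move=> u v lt_u lt_v /=; have := addr_lt lt_u lt_v.
      by case: eqP => [|_]; [lia|rewrite Hm].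
    + move=> l lt_l /=; case: eqP => [|_]; first by lia.
      by rewrite Hl.
    + move=> l lt_l /=; rewrite eqn_add2l; case: eqP => // _.
      by rewrite Hb.
    + rewrite !valueS /= eqxx (_ : value i _ = value i b'); last first.
        by apply: eq_value => l lt_l /=; rewrite ltn_eqF.
      rewrite expnS -(Heq i) //; move: Hv.
      by case: (b' i) (k) => [] [] /=; lia.
    + move=> l lt_l /=; rewrite gtn_eqF // Heq //; lia.
    + by rewrite addn1.
  - by exists b, true, x, y.
apply: tri_conseq H (leqnn _) _ => rs m' [b' [k [x1 [y1 [H1 H2 _ ->]]]]].
by exists b', k, x1, y1.
Qed.

Lemma search_loop mem i j z c f x y : search_mem (fun=> false) mem ->
  tri W (While (CLt 6 1) search_body) (st 0 i j z c f x y 0) mem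
    (2 ^ m * (20 + m * (m * 22 + 22) + 2) + 2)
    (fun rs mem' => exists (d i j z c f x y : nat) (ans : bool),
       rs = st d i j z c f x y ans /\ (ans <-> exists b, valid g L b)).
Proof.
move=> Hmem.
(* Here [d] is the stopping flag. Once it is set the answer is final; before that, every colouring
   with a number below the current one has been refuted, and [e] counts the numbers left, the
   current one included. *)
pose I e rs mem' := exists (d : bool) i j z c f x y (ans : bool),
  rs = st d i j z c f x y ans /\
  if d then ans <-> exists b, valid g L b
  else exists b, [/\ ans = false, search_mem b mem', e + value m b = 2 ^ m &
         forall b', value m b' < value m b -> ~~ valid g L b'].
apply: (tri_while (I := I)).
- move=> e rs mem1 [d [i1 [j1 [z1 [c1 [f1 [x1 [y1 [ans [-> Hd]]]]]]]]]] /=.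
  case: d Hd => // [[b [-> Hmem1 He Hbad]]] _.
  rewrite /search_body.
  apply: tri_const => /=; first by lia.
  apply: tri_const => /=; first by lia.
  apply: (tri_seq (t2 := m * 10 + 10) (vertex_loop Hmem1)); first by nia.
  move=> _ _ [-> [j2 [z2 [c2 [x2 [y2 ->]]]]]].
  (* With the numeral in front, the time bound unfolds to the successors that the rules expect. *)
  rewrite addnC; have lt_b := value_lt m b.
  apply: tri_if => /=; rewrite (eqn_bool _ true) eqb_id => Hp.
    apply: tri_const => /=; first by lia.
    apply: tri_const => /=; first by lia.
    apply: tri_skip; exists 0; first by lia.
    exists true; do 7!eexists; exists true; split; first by [].
    by split=> // _; exists b.
  apply: tri_const => /=; first by lia.
  apply: tri_const => /=; first by lia.
  apply: tri_const => /=; first by lia.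
  apply: (tri_seq (t2 := 1) (carry_loop Hmem1)); first by lia.
  move=> _ mem2 [b' [k [x3 [y3 [Hmem2 Hv ->]]]]].
  apply: tri_move => /=; first exact: bool_W.
  (* The current colouring joins the refuted ones: equal values mean equal bits on the positions of
     [L], hence equal validity. *)
  have Hbad' b2 : value m b2 < (value m b).+1 -> ~~ valid g L b2.
    rewrite ltnS leq_eqVlt => /predU1P[/value_inj E|/Hbad//].
    by rewrite (eq_valid _ E).
  apply: tri_skip; exists (2 ^ m - (value m b).+1); first by lia.
  exists k; do 7!eexists; exists false; split; first by [].
  have := value_lt m b'; case: k Hv => Hv lt'.
    (* A carry out forces [value m b + 1 = 2 ^ m], so all colourings have been refuted. *)
    split=> // [[b2 Hp2]]; have := Hbad' b2; rewrite Hp2; apply.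
    by apply: leq_trans (value_lt m b2) _; lia.
  exists b'; split=> //; first by lia.
  by move=> b2 lt2; apply: Hbad'; lia.
- move=> e rs mem1 [d [i1 [j1 [z1 [c1 [f1 [x1 [y1 [ans [-> Hd]]]]]]]]]] /=.
  by case: d Hd => // Hd _; do 8!eexists; exists ans.
- exists false; do 7!eexists; exists false; split; first by [].
  have E0 : value m (fun=> false) = 0 by rewrite /value big1.
  by exists (fun=> false); rewrite E0 addn0; split.
Qed.

End Run.

(** * Correctness of the kernel *)

(* With [f] the indicator of B, these are the non-edges inside A and the edges
   inside B. *)
Definition clash (g : nat -> nat -> bool) (f : nat -> bool) x y : bool :=
  [&& x != y, f x == f y & g x y == f x].

Definition mt_on g f (S : seq nat) : Prop :=
  forall x, x \in S -> count (clash g f x) S <= 1.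

Lemma valid_mt_on g L f :
  uniq L -> valid g L (fun i => f (nth 0 L i)) <-> mt_on g f L.
Proof.
move=> UL.
have E i : i < size L -> count (conflict g L (fun i => f (nth 0 L i)) i)
    (iota 0 (size L)) = count (clash g f (nth 0 L i)) L.
  move=> lt_i; rewrite -[X in _ = count _ X](mkseq_nth 0 L) count_map.
  apply: eq_in_count => j; rewrite mem_iota add0n => /= lt_j.
  by rewrite /conflict /clash /= nth_uniq.
split=> [/allP H x /(nthP 0)[i lt_i <-]|H].
  by rewrite -E //; apply: H; rewrite mem_iota.
apply/allP => i; rewrite mem_iota add0n => /= lt_i.
by rewrite E //; apply/H/mem_nth.
Qed.

Lemma validP g L : uniq L ->
  (exists b, valid g L b) <-> (exists f, mt_on g f L).
Proof.
move=> UL; split=> [[b Hb]|[f /(valid_mt_on _ _ UL) Hf]]; last by eexists; exact: Hf.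
exists (fun x => b (index x L)); apply/valid_mt_on => //.
by rewrite (@eq_valid _ _ _ b) // => i lt_i; rewrite index_uniq.
Qed.

Lemma mt_on_eq g f S S' : perm_eq S S' -> mt_on g f S -> mt_on g f S'.
Proof.
move=> /[dup] /permP E /perm_mem E' H x; rewrite -E' -E; exact: H.
Qed.

Lemma mt_on_subseq g f S S' : subseq S' S -> mt_on g f S -> mt_on g f S'.
Proof.
move=> sub H x xS'; apply: leq_trans (H x (mem_subseq sub xS')).
exact: leq_count_subseq.
Qed.

Section Extend.

Variables (g : nat -> nat -> bool) (n : nat).
Hypothesis g_sym : forall x y, g x y = g y x.

(* Among five twins of [v], three get the same colour; then [v] can be given
   that colour too, as a vertex clashing with [v] would clash with at least two
   of the three. *)
Lemma mt_on_extend f v S (X : seq nat) : uniq S -> v \notin S ->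
  {in S, forall y, y < n} ->
  uniq X -> {subset X <= S} -> {in X, forall u, twin g n u v} -> 5 <= size X ->
  mt_on g f S -> exists f', mt_on g f' (v :: S).
Proof.
move=> US vS Sn UX XS HX X5 Hf.
(* Pigeonhole on two colours and at least five twins. *)
have [c Hc] : exists c, 3 <= count (fun u => f u == c) X.
  have := count_predC (fun u => f u == true) X.
  have -> : count (predC (fun u => f u == true)) X = count (fun u => f u == false) X.
    by apply: eq_count => u /=; case: (f u).
  case: (leqP 3 (count (fun u => f u == true) X)) => H; first by exists true.
  by exists false; lia.
pose f' x := if x == v then c else f x.
have f'S y : y \in S -> f' y = f y.
  by rewrite /f'; case: eqP => // -> /(negP vS).
have f'v : f' v = c by rewrite /f' eqxx.
have noclash y : y \in S -> clash g f' v y = false.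
  move=> yS; apply/negP; rewrite /clash f'v f'S // => /and3P[vy /eqP cy gvy].
  have := Hf y yS; rewrite leqNgt => /negP; apply.
  (* At least two twins of colour [c] differ from [y]. Each is adjacent to [y] exactly when [v] is,
     so it clashes with [y] if [v] does. *)
  pose p u := (f u == c) && (u != y).
  apply: (@leq_trans (count p X)).
    rewrite -(leq_add2r 1) (leq_trans Hc) //.
    apply: (@leq_trans (count (predU p (pred1 y)) X)).
      by apply: sub_count => u /= Hu; rewrite /p Hu; case: eqP.
    apply: (@leq_trans (count p X + count (pred1 y) X)).
      by rewrite -count_predUI leq_addr.
    by rewrite leq_add2l count_uniq_mem //; case: (_ \in _).
  rewrite -!size_filter; apply: uniq_leq_size; first exact: filter_uniq.
  move=> u; rewrite !mem_filter => /andP[/andP[/eqP fu uy] uX].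
  rewrite XS // andbT /clash eq_sym uy -cy fu eqxx /= g_sym.
  have /allP/(_ y) := HX u uX; rewrite mem_iota add0n Sn //= => /(_ isT).
  by rewrite eq_sym (negPf uy) eq_sym (negPf vy) /= => /eqP ->.
exists f' => x; rewrite inE => /predU1P[->|xS] /=.
  rewrite {1}/clash eqxx /= add0n.
  by rewrite (eq_in_count (a2 := pred0)) ?count_pred0 // => y /noclash.
(* By the symmetry of clashes, the old vertices gain none from [v] either. *)
have -> : clash g f' x v = false.
  rewrite -(noclash x xS) /clash eq_sym g_sym (eq_sym (f' x)).
  by case: eqP => //= _; case: eqP => //= ->.
apply: leq_trans (Hf x xS); rewrite add0n.
rewrite (@eq_in_count _ _ (clash g f x)) // => y yS.
by rewrite /clash !f'S.
Qed.

(** A colouring of the whole restricts to the kernel. Conversely, the missing vertices are added in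
    increasing order: [S i] is the kernel with all vertices below [i], so when [i] is added all its
    earlier twins, at least five, are already coloured. *)
Lemma mt_on_kernel :
  (exists f, mt_on g f (kernel g n n)) <-> (exists f, mt_on g f (iota 0 n)).
Proof.
split=> [[f Hf]|[f Hf]]; last first.
  by exists f; apply: mt_on_subseq Hf; apply: filter_subseq.
pose S i := [seq x <- iota 0 n | (x < i) || in_kernel g n x].
have uS i : uniq (S i) by rewrite filter_uniq ?iota_uniq.
have memS i x : (x \in S i) = (x < n) && ((x < i) || in_kernel g n x).
  by rewrite mem_filter mem_iota add0n andbC.
suff H i : i <= n -> exists f', mt_on g f' (S i).
  have [f' Hf'] := H n (leqnn n); exists f'; apply: mt_on_eq Hf'.
  apply: uniq_perm; rewrite ?iota_uniq // => x.
  by rewrite memS mem_iota add0n /=; case: (x < n).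
elim: i => [_|i IHi lt_i].
  by exists f; rewrite /S /=.
have [f1 Hf1] := IHi (ltnW lt_i).
have ES x : (x \in S i.+1) = (x == i) || (x \in S i).
  rewrite !memS ltnS (leq_eqVlt x); case: eqP => [->|] //=.
  by rewrite lt_i.
case: (boolP (i \in S i)) => iS.
  exists f1; apply: mt_on_eq Hf1; apply: uniq_perm => // x.
  by rewrite ES; case: eqP => [->|].
have [f2 Hf2] : exists f2, mt_on g f2 (i :: S i).
  have := iS; rewrite memS lt_i ltnn /= /in_kernel -leqNgt => X5.
  apply: (@mt_on_extend f1 i _ [seq u <- iota 0 i | twin g n u i]) => //.
  - by move=> y; rewrite memS => /andP[].
  - by rewrite filter_uniq ?iota_uniq.
  - move=> u; rewrite mem_filter mem_iota add0n memS => /andP[_ /= lt_u].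
    by rewrite lt_u (ltn_trans lt_u).
  - by move=> u; rewrite mem_filter => /andP[].
  - by rewrite size_filter.
exists f2; apply: mt_on_eq Hf2; apply: uniq_perm => [||x].
- by rewrite /= iS uS.
- exact: uS.
- by rewrite ES inE.
Qed.

End Extend.

(** * From graphs on ordinals to adjacency functions on numbers *)

Section Ordinals.

Variables (n : nat) (G : sgraph 'I_n).

(** The default [false] outside the vertex range makes the function symmetric on all numbers. *)
Definition adjn (u v : nat) : bool :=
  if (insub u, insub v) is (Some i, Some j) then G i j else false.

Lemma adjnE (i j : 'I_n) : adjn i j = G i j.
Proof. by rewrite /adjn !valK. Qed.

Lemma adjn_sym u v : adjn u v = adjn v u.
Proof.
rewrite /adjn; case: insubP => [i _ _|_]; case: insubP => [j _ _|_] //.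
exact: adj_sym.
Qed.

Lemma count_iota_ord (p : pred nat) :
  count p (iota 0 n) = #|[set i : 'I_n | p i]|.
Proof.
rewrite cardsE cardE -val_enum_ord count_map -size_filter.
by rewrite enumT /enum_mem -enumT; congr (size _); apply: eq_filter => i.
Qed.

Lemma input_adj u v : u < n -> v < n -> Defs.mem (input G) (u * n + v) = adjn u v.
Proof.
move=> lt_u lt_v; rewrite /= (adjnE (Ordinal lt_u) (Ordinal lt_v)).
congr nat_of_bool; apply/existsP/idP => [[i /existsP[j /andP[/eqP E]]]|H].
  have n_gt0 : 0 < n by lia.
  (* Quotient and remainder of the address by [n] recover the row and the column. *)
  have Ei : i = Ordinal lt_u.
    apply/val_inj => /=; have := congr1 (divn^~ n) E.
    by rewrite !divnMDl // !divn_small // !addn0.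
  have Ej : j = Ordinal lt_v.
    apply/val_inj => /=; have := congr1 (modn^~ n) E.
    by rewrite !modnMDl !modn_small.
  by rewrite Ei Ej.
by exists (Ordinal lt_u); apply/existsP; exists (Ordinal lt_v); rewrite /= eqxx.
Qed.

Lemma input_zero x : n * n <= x -> Defs.mem (input G) x = 0.
Proof.
move=> le_x /=; case: existsP => // [[i /existsP[j /andP[/eqP E _]]]].
by have := addr_lt (ltn_ord i) (ltn_ord j); lia.
Qed.

(** The non-neighbours of [i] in A include [i] itself. This takes up one of the 2 in the degree
    bound and leaves at most one clash. *)
Lemma maya_tupiP : maya_tupi G <-> exists f, mt_on adjn f (iota 0 n).
Proof.
split.
  move=> /existsP[A /existsP[B /and4P[/eqP AB dAB /forall_inP HA /forall_inP HB]]].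
  have BA i : (i \in B) = (i \notin A).
    have := in_setT i; rewrite -AB inE.
    by case: (boolP (i \in A)) => [/(disjointFr dAB)->|_ /= ->].
  exists (fun x => if insub x is Some i then i \in B else false) => x.
  rewrite mem_iota add0n => /= lt_x; rewrite count_iota_ord.
  have [i ->] : exists i : 'I_n, x = val i by exists (Ordinal lt_x).
  rewrite /clash valK.
  case: (boolP (i \in B)) => iB.
    apply: leq_trans (HB i iB); apply/subset_leq_card/subsetP => j.
    rewrite !inE valK adjnE => /and3P[_ /eqP <- /eqP ->] //.
  have iA : i \in A by move: iB; rewrite BA negbK.
  have := HA i iA; rewrite /deg_in -(cardsID (nbh G i) A) (setIC A).
  rewrite leq_add2l (cardsD1 i (A :\: _)) !inE iA adj_irr /= => H.
  apply: leq_trans (H : _ <= 1); apply/subset_leq_card/subsetP => j.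
  rewrite !inE valK adjnE BA => /and3P[ij /eqP jA /eqP ->].
  by move: jA; rewrite eq_sym ij; case: (j \in A).
move=> [f Hf]; apply/existsP; exists [set i | ~~ f (val i)].
apply/existsP; exists [set i | f (val i)]; apply/and4P; split.
- by apply/eqP/setP => i; rewrite !inE; case: (f i).
- by apply/pred0P => i; rewrite /= !inE; case: (f i).
- apply/forall_inP => i; rewrite inE => Ni.
  have := Hf i; rewrite mem_iota ltn_ord => /(_ isT); rewrite count_iota_ord => H.
  set A := [set _ | _].
  rewrite /deg_in -(cardsID (nbh G i) A) setIC leq_add2l (cardsD1 i).
  rewrite -[2]/(1 + 1); apply: leq_add; first by case: (_ \in _).
  apply: leq_trans H; apply/subset_leq_card/subsetP => j.
  rewrite !inE /clash adjnE => /and3P[ij NG Nj].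
  by rewrite (negPf Ni) (negPf Nj) (negPf NG) /= andbT eq_sym.
- apply/forall_inP => i; rewrite inE => fi.
  have := Hf i; rewrite mem_iota ltn_ord => /(_ isT); rewrite count_iota_ord.
  apply: leq_trans; apply/subset_leq_card/subsetP => j.
  rewrite !inE /clash adjnE fi => /andP[Gij ->]; rewrite Gij !andbT.
  by rewrite -[_ != _]/(i != j :> 'I_n); apply/eqP => E; move: Gij; rewrite E adj_irr.
Qed.

Lemma twin_ord (i j : 'I_n) : same_type G i j -> twin adjn n i j.
Proof.
move=> /eqP/setP E; apply/allP => z; rewrite mem_iota add0n => /= lt_z.
have := E (Ordinal lt_z); rewrite !inE -!val_eqE /=.
rewrite -(adjnE i (Ordinal lt_z)) -(adjnE j (Ordinal lt_z)) /=.
by case: (z == i); case: (z == j) => //= ->.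
Qed.

(** Take the largest kernel vertex of a type class. The other kernel vertices of the class are
    earlier twins of it, and it has fewer than five of these, so each class contains at most five
    kernel vertices. *)
Lemma size_kernel_diversity :
  size (kernel adjn n n) <= 5 * nbh_diversity G.
Proof.
rewrite /nbh_diversity; case: ex_minnP => w /existsP[P /andP[/andP[partP typP] /eqP <-]] _.
rewrite size_filter count_iota_ord; set K := [set _ | _].
have -> : #|K| = \sum_(S in P) #|K :&: S|.
  transitivity (\sum_(i in [set: 'I_n]) (i \in K : nat)).
    by rewrite -sum1_card big_mkcond; apply: eq_big => i; rewrite ?inE.
  rewrite (set_partition_big _ partP); apply: eq_bigr => S _.
  rewrite -sum1_card big_mkcond [RHS]big_mkcond; apply: eq_bigr => i _.
  by rewrite in_setI; case: (i \in S); case: (i \in K).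
rewrite mulnC -sum_nat_const; apply: leq_sum => S SP.
have [->|[v0 v0S]] := set_0Vmem (K :&: S); first by rewrite cards0.
case: (arg_maxnP val v0S) => v vKS maxv; have {}vKS : v \in K :&: S := vKS.
move: (vKS); rewrite !inE => /andP[Kv vS].
rewrite (cardsD1 v) vKS add1n; apply: leq_trans Kv.
rewrite ltnS -size_filter cardE -(size_map val).
apply: uniq_leq_size; first by rewrite map_inj_uniq ?enum_uniq //; apply: val_inj.
move=> _ /mapP[u + ->]; rewrite mem_enum !inE => /andP[uv /andP[Ku uS]].
rewrite mem_filter mem_iota add0n /= ltn_neqAle.
have /forall_inP/(_ S SP)/forall_inP/(_ u uS)/forall_inP/(_ v vS)/twin_ord -> := typP.
by rewrite val_eqE uv; apply: maxv; apply/setIP; rewrite inE.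
Qed.

End Ordinals.

(** * The complete algorithm *)

(** Registers 4, 6, 7 and 14 are used with their initial value 0. *)
Definition recognize : com :=
  Const 1 1 ;; Const 2 5 ;; Op Mul 3 0 0 ;; Op Add 5 3 0 ;;
  While (CLt 7 0) kernel_body ;; While (CLt 6 1) search_body ;;
  Move 0 14 ;; Skip.

Lemma recognize_correct W n (G : sgraph 'I_n) :
  let m := size (kernel (adjn G) n n) in
  n * n + 2 * n + 8 <= W ->
  tri W recognize (n :: nseq 14 0) (Defs.mem (input G))
    (9 + n * (12 + n * (n * 22 + 12) + 2)
       + 2 ^ m * (20 + m * (m * 22 + 22) + 2))
    (fun rs _ => nth 0 rs 0 = maya_tupi G).
Proof.
move=> m HW; rewrite /recognize.
rewrite -addnA.
apply: tri_const => /=; first by lia.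
apply: tri_const => /=; first by lia.
apply: tri_op => /=; first by lia.
apply: tri_op => /=; first by lia.
have Hadj : adj_mem n (adjn G) (Defs.mem (input G)) by move=> u v; apply: input_adj.
apply: (tri_seq (t2 := 3 + 2 ^ m * (20 + m * (m * 22 + 22) + 2))
  (kernel_loop (W := W) HW Hadj (@input_zero _ G))); first by lia.
move=> _ mem1 [Hm Hl H0 [j [z [c [f [a [b ->]]]]]]].
have lt_k i : i < m -> nth 0 (kernel (adjn G) n n) i < n.
  by move/(mem_nth 0); rewrite mem_filter mem_iota => /andP[_ /andP[]].
have Hs : search_mem n (adjn G) (kernel (adjn G) n n) (fun=> false) mem1.
  by split=> // i lt_i; rewrite H0 ?leq_addr.
apply: (tri_seq (t2 := 1) (search_loop HW lt_k (size_kernel _ _ _) Hs)).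
  by rewrite -/m; lia.
move=> _ mem2 [d [i [j2 [z2 [c2 [f2 [a2 [b2 [ans [-> Hans]]]]]]]]]].
apply: tri_move => /=; first by case: (ans); lia.
apply: tri_skip => /=; congr nat_of_bool; apply/idP/idP.
  move/Hans/validP => /(_ _); rewrite filter_uniq ?iota_uniq // => /(_ isT).
  by move/(mt_on_kernel _ (adjn_sym G))/maya_tupiP.
move/maya_tupiP/(mt_on_kernel _ (adjn_sym G)) => H; apply/Hans/validP => //.
by rewrite filter_uniq ?iota_uniq.
Qed.

(** * The running time *)

(** For [k <= a] the constant factor suffices, and for [a <= k] the factor [k ^ k] does. With
    [a = 32] this absorbs the number of colourings. *)
Lemma expn_le_selfexp a k : 0 < k -> a ^ k <= a ^ a * k ^ k.
Proof.
move=> k_gt0; case: a => [|a]; first by rewrite exp0n.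
case: (leqP k a.+1) => [le_ka|/ltnW le_ak].
  apply: leq_trans (leq_pmulr _ _); last by rewrite expn_gt0 k_gt0.
  exact: leq_pexp2l.
apply: leq_trans (leq_pmull _ _); last by rewrite expn_gt0.
by rewrite leq_exp2r.
Qed.

Lemma search_time_bound :
  exists K, forall k m, 0 < k -> m <= 5 * k ->
    2 ^ m * (20 + m * (m * 22 + 22) + 2) <= K * k ^ (k + 2).
Proof.
have [K HK] : exists K, forall k, 0 < k -> (2 ^ 5) ^ k <= K * k ^ k.
  by exists ((2 ^ 5) ^ (2 ^ 5)) => k; apply: expn_le_selfexp.
(* The polynomial factor is at most [22 * (m + 1) ^ 2], and [m + 1 <= 6 * k]; this gives
   [792 = 22 * 36]. *)
exists (K * 792) => k m k_gt0 le_m.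
have le_2m : 2 ^ m <= K * k ^ k.
  by apply: leq_trans (HK k k_gt0); rewrite -expnM leq_exp2l.
have le_m2 : 20 + m * (m * 22 + 22) + 2 <= 792 * k ^ 2 by nia.
by rewrite expnD mulnACA; apply: leq_mul.
Qed.

Theorem proposition3p7 :
  exists (P : program) (c C : nat),
    forall (k n : nat) (G : sgraph 'I_n),
      0 < k -> nbh_diversity G <= k ->
      answers_within c P G (maya_tupi G) (C * (n ^ 3 + k ^ (k + 2))).
Proof.
have [K HK] := search_time_bound.
(* The program does not receive [k], which enters only through the size of the kernel. The exponent
   3 makes the word range at least [n * n + 2 * n + 8], with equality at [n = 0]. The sum of the
   coefficients 9, 14, 12 and 22 of the kernel phase is 57; for [n = 0] its constant term is covered
   by [k ^ (k + 2) >= 1]. *)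
exists (compile 0 recognize), 3, (57 + K) => k n G k_gt0 le_k.
have HW : n * n + 2 * n + 8 <= n.+2 ^ 3 by rewrite !expnS expn0; nia.
have Hreg : reg (input G) =1 nth 0 (n :: nseq 14 0).
  by move=> [|x] //; rewrite -[RHS]/(nth 0 (nseq 14 0) x) nth_nseq if_same.
have [t [f [rs [m [le_t Hrun Hf Hans]]]]] :=
  recognize_correct G HW (code_at_self _) Hreg.
exists t, (State (0 + csize recognize) f m); split=> //.
- apply: leq_trans le_t _.
  have := HK k (size (kernel (adjn G) n n)) k_gt0.
  have le_m := size_kernel_diversity G.
  have: size (kernel (adjn G) n n) <= 5 * k by lia.
  move=> le_mk /(_ le_mk).
  set T := 2 ^ _ * _; move: (k ^ (k + 2)) (expn_gt0 k (k + 2)) => E.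
  rewrite k_gt0 /= !expnS expn0 => E_gt0 HT.
  by nia.
- by rewrite /= Hf.
Qed.
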